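(* Let $A$ and $B$ be two self-adjoint operators in $H$ such that $B$ is bounded (i.e. $B\in B(H)$), while $A$ is not necessarily bounded. If $\sigma(BA)\neq\mathbb{C}$, then $$\sigma(AB)=\sigma(BA).$$
   Context: $H$ is a complex separable Hilbert space; operators are linear, possibly unbounded; $B(H)$ is the set of everywhere defined bounded linear operators on $H$. For operators $S,T$ in $H$, $ST$ has domain $\{x\in D(T): Tx\in D(S)\}$. Spectrum: for an operator $T$ with domain $D(T)\subset H$ (not necessarily bounded, closed or densely defined), $\lambda\in\mathbb{C}$ is not in $\sigma(T)$ iff $T-\lambda$ is injective and $(T-\lambda)^{-1}\in B(H)$. *)

(* Defs.v *)
From HB Require Import structures.
From mathcomp Require Import all_boot all_order all_algebra.
From mathcomp Require Import sesquilinear complex.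
From mathcomp Require Import all_classical all_reals all_analysis.

Set Implicit Arguments.
Unset Strict Implicit.
Unset Printing Implicit Defensive.

Import Order.TTheory GRing.Theory Num.Theory.
Import numFieldNormedType.Exports.

Local Open Scope classical_set_scope.
Local Open Scope ring_scope.

(* [inner] is linear in its first argument and conjugate-linear in the second.
   As a number field, R[i] carries the partial order in which 0 <= z means that
   z is a nonnegative real, and norms are valued in R[i]. *)
HB.mixin Record NormedModule_hasInner (R : realType) (H : Type)
    of NormedModule R[i] H := {
  inner : {dot H for (@Num.conj R[i])};
  inner_normE : forall x : H, inner x x = `|x| ^+ 2
}.

#[short(type="hilbertType")]
HB.structure Definition Hilbert (R : realType) :=
  { H of CompleteNormedModule R[i] H & NormedModule_hasInner R H }.

Definition separable (T : topologicalType) : Prop :=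
  exists2 S : set T, countable S & dense S.

(* A possibly unbounded linear operator. The values of [op_fun] outside of
   [dom] are irrelevant. *)
Record operator (R : realType) (H : hilbertType R) := Operator {
  dom : set H;
  op_fun :> H -> H;
  dom0 : dom 0;
  domL : forall (a : R[i]) (x y : H), dom x -> dom y -> dom (a *: x + y);
  op_funL : forall (a : R[i]) (x y : H), dom x -> dom y ->
    op_fun (a *: x + y) = a *: op_fun x + op_fun y
}.

Section Operators.
Context {R : realType} {H : hilbertType R}.
Implicit Types S T : operator H.

Definition op_eq S T : Prop :=
  dom S = dom T /\ forall x, dom S x -> S x = T x.

Definition everywhere_bounded T : Prop :=
  dom T = setT /\ exists M : R[i], forall x : H, `|T x| <= M * `|x|.

Lemma op_fun0 T : T 0 = 0.
Proof.
have := op_funL (-1) (dom0 T) (dom0 T).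
by rewrite scaler0 add0r scaleN1r addNr.
Qed.

Section Composition.
Variables S T : operator H.

Definition comp_dom : set H := [set x | dom T x /\ dom S (T x)].

Lemma comp_dom0 : comp_dom 0.
Proof. by split; [exact: dom0 | rewrite op_fun0; exact: dom0]. Qed.

Lemma comp_domL (a : R[i]) (x y : H) :
  comp_dom x -> comp_dom y -> comp_dom (a *: x + y).
Proof.
move=> [Tx Sx] [Ty Sy]; split; first exact: domL.
by rewrite op_funL //; exact: domL.
Qed.

Lemma comp_funL (a : R[i]) (x y : H) : comp_dom x -> comp_dom y ->
  S (T (a *: x + y)) = a *: S (T x) + S (T y).
Proof. by move=> [Tx Sx] [Ty Sy]; rewrite !op_funL. Qed.

Definition op_comp : operator H := Operator comp_dom0 comp_domL comp_funL.

End Composition.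

Section Shift.
Variables (T : operator H) (l : R[i]).

Lemma shift_funL (a : R[i]) (x y : H) : dom T x -> dom T y ->
  T (a *: x + y) - l *: (a *: x + y) =
  a *: (T x - l *: x) + (T y - l *: y).
Proof.
move=> Tx Ty; rewrite op_funL // scalerDr scalerBr !scalerA (mulrC l a).
by rewrite opprD addrACA.
Qed.

Definition op_shift : operator H := Operator (dom0 T) (@domL _ _ T) shift_funL.

End Shift.

Section Inverse.
Variables (T : operator H) (Tinj : set_inj (dom T) T).

Definition inv_fun (y : H) : H := xget 0 [set x | dom T x /\ T x = y].

Lemma inv_funE (x : H) : dom T x -> inv_fun (T x) = x.
Proof.
move=> Tx; rewrite /inv_fun; case: xgetP => [z _ [Tz Tzx]|/(_ x)[]//].
by apply: Tinj; rewrite ?inE.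
Qed.

Lemma inv_dom0 : (T @` dom T) 0.
Proof. by exists 0; [exact: dom0 | exact: op_fun0]. Qed.

Lemma inv_domL (a : R[i]) (x y : H) :
  (T @` dom T) x -> (T @` dom T) y -> (T @` dom T) (a *: x + y).
Proof.
move=> [u Tu <-] [v Tv <-].
by exists (a *: u + v); [exact: domL | rewrite op_funL].
Qed.

Lemma inv_funL (a : R[i]) (x y : H) :
  (T @` dom T) x -> (T @` dom T) y ->
  inv_fun (a *: x + y) = a *: inv_fun x + inv_fun y.
Proof.
move=> [u Tu <-] [v Tv <-].
by rewrite -op_funL // !inv_funE //; exact: domL.
Qed.

Definition op_inv : operator H := Operator inv_dom0 inv_domL inv_funL.

End Inverse.

Definition spectrum T : set R[i] :=
  [set l | ~ exists Tinj : set_inj (dom (op_shift T l)) (op_shift T l),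
             everywhere_bounded (op_inv Tinj)].

Section Adjoint.
Variables (T : operator H) (Tdense : dense (dom T)).

Definition adj_rel (y z : H) : Prop :=
  forall x, dom T x -> inner (T x) y = inner x z.

Definition adj_dom : set H := [set y | exists z, adj_rel y z].

Definition adj_fun (y : H) : H := xget 0 [set z | adj_rel y z].

Lemma adj_rel0 : adj_rel 0 0.
Proof. by move=> x _; rewrite !linear0r. Qed.

Lemma adj_relL (a : R[i]) (y y' z z' : H) :
  adj_rel y z -> adj_rel y' z' -> adj_rel (a *: y + y') (a *: z + z').
Proof. by move=> yz yz' x Tx; rewrite !linearPr /= yz // yz'. Qed.

Lemma adj_rel_uniq (y z z' : H) : adj_rel y z -> adj_rel y z' -> z = z'.
Proof.
move=> yz yz'; apply/eqP; rewrite -subr_eq0; apply/negPn/negP => w0.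
set w := z - z' in w0.
have orth x : dom T x -> inner x w = 0.
  by move=> Tx; rewrite linearBr /= -yz // -yz' // subrr.
clearbody w; have w_gt0 : 0 < `|w| by rewrite normr_gt0.
have wball0 : ball w `|w| !=set0 by exists w; exact: ballxx.
have [x [wx Tx]] := @Tdense _ wball0 (ball_open w `|w|).
have orth' : inner w x = 0 by rewrite hermC /= orth // rmorph0 mulr0.
move: wx; rewrite -ball_normE /= => wx.
have : `|w - x| ^+ 2 < `|w| ^+ 2 by rewrite ltr_pXn2r// nnegrE.
rewrite -!inner_normE linearBr !linearBl /= orth' (orth x Tx).
by rewrite subr0 sub0r opprK gtrDl inner_normE le_gtF ?exprn_ge0.
Qed.

Lemma adj_funE (y z : H) : adj_rel y z -> adj_fun y = z.
Proof.
move=> yz; rewrite /adj_fun; case: xgetP => [w _ yw|/(_ z)//].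
exact: adj_rel_uniq yw yz.
Qed.

Lemma adj_dom0 : adj_dom 0.
Proof. by exists 0; exact: adj_rel0. Qed.

Lemma adj_domL (a : R[i]) (x y : H) :
  adj_dom x -> adj_dom y -> adj_dom (a *: x + y).
Proof. by move=> [u xu] [v yv]; exists (a *: u + v); exact: adj_relL. Qed.

Lemma adj_funL (a : R[i]) (x y : H) : adj_dom x -> adj_dom y ->
  adj_fun (a *: x + y) = a *: adj_fun x + adj_fun y.
Proof.
move=> [u xu] [v yv].
by rewrite (adj_funE xu) (adj_funE yv); apply: adj_funE; exact: adj_relL.
Qed.

Definition op_adj : operator H := Operator adj_dom0 adj_domL adj_funL.

End Adjoint.

Definition selfadjoint T : Prop :=
  exists Tdense : dense (dom T), op_eq (op_adj Tdense) T.

End Operators.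

(* Main.v *)
Require Import Defs.
From mathcomp Require Import all_boot all_order all_algebra.
From mathcomp Require Import sesquilinear complex.
From mathcomp Require Import all_classical all_reals all_analysis.
From mathcomp Require Import ring.

Set Implicit Arguments.
Unset Strict Implicit.
Unset Printing Implicit Defensive.

Import Order.TTheory GRing.Theory Num.Theory.
Import numFieldNormedType.Exports.

Local Open Scope classical_set_scope.
Local Open Scope ring_scope.

(** Since [B] is bounded and both operators are self-adjoint, [AB] is the
    adjoint of [BA].  The spectra are compared through three transfers of
    resolvents.

    - A resolvent [S] of [BA] at [l] has an adjoint [S'], and [S'] is a
      resolvent of [AB] at the conjugate of [l] ([resolvent_BA_AB]); that the
      range of [S'] lies in the domain of [AB] rests on the self-adjointness,
      not just the symmetry, of [A].
    - Conversely, a resolvent [S] of [AB] at [m] has an adjoint which is a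
      resolvent of [BA] at the conjugate of [m] ([resolvent_AB_BA]).  This is
      the step that requires [BA] to have some resolvent [S0] at a point [l0]:
      the adjoint of the resolvent identity between [S] and the adjoint of [S0]
      exhibits the values of [S'] as values of [S0], hence as elements of the
      domain of [BA].
    - For [l != 0], a resolvent [S] of [BA] at [l] gives the resolvent
      [(A S B - 1) / l] of [AB] at the same [l] ([resolvent_BA_AB_neq0]), by the
      algebra of Jacobson's lemma.  Here [A S] is everywhere defined, and its
      boundedness is an instance of the closed graph theorem.

    So the resolvent set of [AB] is the conjugate of that of [BA]; away from [0]
    the latter is contained in the former, hence both are stable under
    conjugation and equal, while [0] is its own conjugate.

    The two facts of Hilbert space theory behind this are the Riesz
    representation theorem, which provides adjoints of bounded operators, and
    the uniform boundedness principle in the form that a weakly bounded set is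
    bounded in norm.  The first comes from a minimizing sequence on an affine
    hyperplane, the second from a gliding hump. *)

(** * Limits controlled by complex-valued norms *)

Section ComplexScalars.
Variable R : realType.
Implicit Types a c e : R[i].

Lemma exists_natSinv_lt e : 0 < e -> exists n : nat, n.+1%:R^-1 < e.
Proof.
move=> e0; have := gtr0_real e0 => /RRe_real eE.
have r0 : 0 < complex.Re e by rewrite -ltcR eE.
have [N _ /(_ N (leqnn N)) /= NP] := near_infty_natSinv_lt (PosNum r0).
exists N; rewrite -eE.
have -> : (N.+1%:R^-1 : R[i]) = (N.+1%:R^-1)%:C%C.
  by rewrite fmorphV rmorph_nat.
by rewrite ltcR.
Qed.

Lemma exists_nat_gt e : e \is Num.real -> exists n : nat, e < n%:R.
Proof.
move=> eR; have e1 : 0 < `|e| + 1 by rewrite ltr_wpDl.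
have [n nP] := exists_natSinv_lt (etrans (invr_gt0 _) e1).
exists n.+1; move: nP; rewrite ltf_pV2 ?posrE// => nP.
by rewrite (le_lt_trans _ nP)// (le_trans (real_ler_norm eR))// lerDl.
Qed.

Lemma eq0_le_natSinv a c : (forall n, `|a| <= c * n.+1%:R^-1) -> a = 0.
Proof.
move=> ac; apply: contrapT => /eqP; rewrite -normr_gt0 => a0.
have c0 : 0 < c by have := ac 0%N; rewrite invr1 mulr1; exact: lt_le_trans.
have [n] := exists_natSinv_lt (divr_gt0 a0 c0).
rewrite ltr_pdivlMr// mulrC => /(le_lt_trans (ac n)).
by rewrite ltxx.
Qed.

(** Complex numbers are only partially ordered, but nonnegative ones are real, so
    the infimum can be taken on the real parts. *)
Lemma complex_inf (T : Type) (P : set T) (q : T -> R[i]) :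
  P !=set0 -> (forall t, 0 <= q t) ->
  exists d, (forall t, P t -> d <= q t) /\
    (forall e, 0 < e -> exists2 t, P t & q t < d + e).
Proof.
move=> [t0 Pt0] q0.
have qE t : ((complex.Re (q t))%:C)%C = q t.
  by apply: RRe_real; exact: ger0_real.
pose E := [set complex.Re (q t) | t in P].
have Einf : has_inf E.
  split; first by exists (complex.Re (q t0)), t0.
  by exists 0 => _ [t _ <-]; rewrite -lecR qE.
exists ((inf E)%:C)%C; split=> [t Pt|e e0].
  by rewrite -qE lecR; apply: ge_inf; [exact: Einf.2|exists t].
have eE := RRe_real (gtr0_real e0).
have e0' : 0 < complex.Re e by rewrite -ltcR eE.
have [_ [t Pt <-] lt_e] := inf_adherent e0' Einf.
by exists t => //; rewrite -qE -eE -rmorphD ltcR.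
Qed.

End ComplexScalars.

(** An operator bound [M] may be negative when the space is trivial; this
    replaces it by a nonnegative one. *)
Lemma le_mul_norm (K : numDomainType) (a M b : K) :
  0 <= a -> 0 <= b -> a <= M * b -> a <= `|M| * b.
Proof.
move=> a0 b0 aMb; rewrite -(ger0_norm b0) -normrM ger0_norm//.
exact: le_trans aMb.
Qed.

(** Keeping the same rate in the conclusion makes the errors of the two
    limiting constructions below explicit, so that no further estimate on the
    limit is needed. *)
Lemma cauchy_rate_cvg (K : numFieldType) (V : completeNormedModType K)
    (u : nat -> V) (eps : nat -> K) :
    (forall e, 0 < e -> exists n, eps n < e) ->
    (forall n m, (n <= m)%N -> `|u n - u m| <= eps n) ->
  exists l, forall n, `|u n - l| <= eps n.
Proof.
move=> eps0 u_eps.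
have /cauchy_cvgP ul : cauchy (u @ \oo).
  apply: cauchy_exP => e e0; have [n ne] := eps0 _ e0.
  exists (u n); exists n => // m /= nm; rewrite -ball_normE /=.
  exact: le_lt_trans (u_eps _ _ nm) ne.
exists (lim (u @ \oo)) => n.
have eR : eps n \is Num.real by apply: ger0_real; apply: le_trans (u_eps n n _).
rewrite real_leNgt//; apply/negP => lt_eps.
have /cvgrPdist_lt/(_ (`|u n - lim (u @ \oo)| - eps n)) := ul.
rewrite subr_gt0 => /(_ lt_eps) [N _ /(_ (maxn n N) (leq_maxr _ _))] /=.
rewrite distrC ltrBrDr => ult.
have tri := ler_distD (u (maxn n N)) (u n) (lim (u @ \oo)).
have := le_lt_trans (le_trans tri (lerD (u_eps n _ (leq_maxl n N)) (lexx _))).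
by move=> /(_ `|u n - lim (u @ \oo)|); rewrite addrC ltxx => /(_ ult).
Qed.

(** * Inner products *)

(** The minimum of the quadratic polynomial [a |-> `|x - a *: y| ^+ 2] is reached
    at [a = c / n], where [c] is the inner product of [x] and [y], and [n] the
    square of the norm of [y]. *)
Lemma completed_square (C : numClosedFieldType) (c n t : C) : 0 < n ->
  t + `|c / n| ^+ 2 * n - ((c / n)^* * c + ((c / n)^* * c)^*) =
  t - `|c| ^+ 2 / n.
Proof.
move=> n0; have nJ : n^* = n by apply/CrealP; exact: gtr0_real.
rewrite normrM normfV (gtr0_norm n0) exprMn normCK !rmorphM !fmorphV /=.
by rewrite conjCK !nJ; field; rewrite gt_eqF.
Qed.

Section Inner.
Variables (R : realType) (H : hilbertType R).
Local Notation "''[' u , v ]" := (inner u v) : ring_scope.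
Implicit Types x y z : H.

Lemma innerC x y : '[x, y] = '[y, x]^*.
Proof. by rewrite hermC /= expr0 mul1r. Qed.

Lemma innerZl a x y : '[a *: x, y] = a * '[x, y].
Proof. by rewrite linearZl_LR. Qed.

Lemma innerZr a x y : '[x, a *: y] = a^* * '[x, y].
Proof. by rewrite linearZr_LR. Qed.

Lemma inner_injr y z : (forall x, '[x, y] = '[x, z]) -> y = z.
Proof.
move=> yz; apply/eqP; rewrite -subr_eq0 -normr_eq0 -sqrf_eq0 -inner_normE.
by rewrite linearBr /= yz subrr.
Qed.

Lemma normD_sqr x y :
  `|x + y| ^+ 2 = `|x| ^+ 2 + `|y| ^+ 2 + ('[x, y] + '[x, y]^*).
Proof. by rewrite -!inner_normE dnormD. Qed.

Lemma normB_sqr x y :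
  `|x - y| ^+ 2 = `|x| ^+ 2 + `|y| ^+ 2 - ('[x, y] + '[x, y]^*).
Proof. by rewrite -!inner_normE dnormB. Qed.

Lemma parallelogram x y :
  `|x + y| ^+ 2 + `|x - y| ^+ 2 = 2 * (`|x| ^+ 2 + `|y| ^+ 2).
Proof. by rewrite normD_sqr normB_sqr; ring. Qed.

(** If [x] almost minimizes the norm on the line through [x] directed by [y],
    then [x] is almost orthogonal to [y]. With [d = 0] this is the
    Cauchy-Schwarz inequality. *)
Lemma sqr_inner_le_gap x y d :
  (forall a, d <= `|x + a *: y| ^+ 2) ->
  `|'[x, y]| ^+ 2 <= (`|x| ^+ 2 - d) * `|y| ^+ 2.
Proof.
move=> xd; have [->|y0] := eqVneq y 0.
  by rewrite linear0r normr0 expr0n /= ?(mulr0, normr0, expr0n).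
have ny0 : 0 < `|y| ^+ 2 by rewrite exprn_gt0 ?normr_gt0.
have := xd (- ('[x, y] / `|y| ^+ 2)).
rewrite scaleNr normB_sqr normrZ innerZr exprMn completed_square//.
by rewrite -ler_pdivrMr// lerBrDr addrC -lerBrDr.
Qed.

Lemma CauchySchwarz_inner x y : `|'[x, y]| <= `|x| * `|y|.
Proof.
rewrite -(@ler_pXn2r _ 2%N)// ?nnegrE ?mulr_ge0// exprMn.
rewrite -[`|x| ^+ 2]subr0; apply: sqr_inner_le_gap => a.
by rewrite exprn_ge0.
Qed.

(** * Weakly bounded sets *)

(** Let [s] be the positive multiple of [w] of the prescribed length. The values
    of [inner _ w] at [x + s] and [x - s] differ by [2 * inner s w], so one of them
    is at least [inner s w] in absolute value. *)
Lemma gliding_step n x w : w != 0 -> exists x',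
  `|x - x'| <= 3^-1 ^+ n.+1 /\ 3^-1 ^+ n.+1 * `|w| <= `|'[x', w]|.
Proof.
move=> w0; set t := 3^-1 ^+ n.+1.
have nw0 : 0 < `|w| by rewrite normr_gt0.
have t0 : 0 < t by rewrite exprn_gt0// invr_gt0.
pose s := (t / `|w|) *: w.
have ns : `|s| = t.
  by rewrite normrZ gtr0_norm ?divr_gt0// divfK ?gt_eqF.
have sw : '[s, w] = t * `|w|.
  by rewrite innerZl inner_normE expr2 mulrA divfK ?gt_eqF.
have tR : t * `|w| \is Num.real by rewrite ger0_real// mulr_ge0// ltW.
have [h1|h1] := real_leP tR (normr_real '[x + s, w]).
  by exists (x + s); split=> //; rewrite opprD addNKr normrN ns.
exists (x - s); split; first by rewrite opprB addrC subrK ns.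
rewrite linearDl linearBl /= sw in h1 *.
have := ler_normB ('[x, w] + t * `|w|) ('[x, w] - t * `|w|).
rewrite (_ : _ + _ - _ = 2 * (t * `|w|)); last by ring.
rewrite normrM (ger0_norm (mulr_ge0 (ltW t0) (ltW nw0))) normr_nat => le2.
have := le_trans le2 (lerD (ltW h1) (lexx _)).
by rewrite mulr_natl mulr2n lerD2l.
Qed.

(** If [W] were unbounded, pick vectors [w n] of [W] of norm much larger than
    [3 ^+ n.+1] and a sequence [u] in which the [n]-th step, of length
    [3^-1 ^+ n.+1], makes the product with [w n] large. The later steps add up to
    at most half of that length, so the limit still has a product with [w n] of
    absolute value at least [n], for every [n]. *)
Lemma weakly_bounded_bounded (W : set H) :
  (forall x, exists C, forall w, W w -> `|'[x, w]| <= C) ->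
  exists M, forall w, W w -> `|w| <= M.
Proof.
move=> Wb; apply: contrapT => nM.
have /choice[w wP] n : exists w, W w /\ 2 * 3 ^+ n.+1 * n%:R < `|w|.
  apply: contrapT => nw; apply: nM; exists (2 * 3 ^+ n.+1 * n%:R) => w Ww.
  have BR : 2 * 3 ^+ n.+1 * n%:R \is @Num.real R[i].
    by rewrite ger0_real// !mulr_ge0// exprn_ge0.
  rewrite real_leNgt ?ger0_real//.
  by apply/negP => ltw; apply: nw; exists w.
have w0 n : w n != 0.
  by rewrite -normr_gt0 (le_lt_trans _ (wP n).2)// !mulr_ge0.
have /choice[f fP] (p : nat * H) := gliding_step p.1 p.2 (w0 p.1).
pose u := fix u n := if n is m.+1 then f (m, u m) else 0.
(* [eps n] bounds the total length of the steps after [u n]. *)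
pose eps n : R[i] := 3^-1 ^+ n / 2.
have epsS n : eps n - eps n.+1 = 3^-1 ^+ n.+1 by rewrite /eps exprS; field.
have epsE e : 0 < e -> exists n, eps n < e.
  move=> /exists_natSinv_lt[n ne]; exists n; apply: le_lt_trans ne.
  rewrite /eps exprVn -invfM lef_pV2 ?posrE//.
  by rewrite -natrX -natrM ler_nat (leq_trans (@ltn_expl 3 n _))// leq_pmulr.
have uP n m : (n <= m)%N -> `|u n - u m| <= eps n - eps m.
  move=> /subnKC <-; elim: (m - n)%N => [|k IH].
    by rewrite addn0 !subrr normr0.
  rewrite addnS; apply: le_trans (ler_distD (u (n + k)%N) _ _) _.
  have := lerD IH (fP ((n + k)%N, u (n + k)%N)).1.
  rewrite /= -epsS => /le_trans; apply.
  by rewrite addrA subrK.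
have [l lP] : exists l, forall n, `|u n - l| <= eps n.
  apply: (@cauchy_rate_cvg _ H) => // n m /uP/le_trans; apply.
  by rewrite gerBl ?/eps ?divr_ge0 ?exprn_ge0 ?invr_ge0.
have [C CP] := Wb l.
have CR : C \is Num.real by apply: ger0_real; apply: le_trans (CP _ (wP 0%N).1).
have [n nC] := exists_nat_gt CR.
have [Ww lew] := wP n.
suff /lt_le_trans/(_ (CP _ Ww)) : C < `|'[l, w n]| by rewrite ltxx.
apply: lt_le_trans nC _ => {C CP CR}.
have large : eps n.+1 * `|w n| <= `|'[l, w n]|.
  have near : `|'[u n.+1 - l, w n]| <= eps n.+1 * `|w n|.
    by rewrite (le_trans (CauchySchwarz_inner _ _))// ler_wpM2r.
  rewrite -(lerD2r (eps n.+1 * `|w n|)) -mulrDl.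
  rewrite (_ : eps n.+1 + eps n.+1 = 3^-1 ^+ n.+1); last by rewrite /eps; field.
  apply: le_trans (fP (n, u n)).2 _.
  rewrite -[f _](subrK l) addrC linearDl /=.
  by apply: le_trans (ler_normD _ _) _; rewrite lerD2l.
apply: le_trans large; rewrite /eps exprVn -invfM.
rewrite ler_pdivlMl ?mulr_gt0 ?exprn_gt0//.
by apply: ltW; rewrite [_ * 2]mulrC.
Qed.

(** * Riesz representation *)

(** The vector of least norm [l] in the hyperplane [f v = 1] is orthogonal to the
    kernel of [f], so [f] is the inner product with a multiple of [l]. The
    parallelogram law makes minimizing sequences converge to it. *)
Lemma riesz (f : H -> R[i]) (M : R[i]) :
  (forall a x y, f (a *: x + y) = a * f x + f y) ->
  (forall x, `|f x| <= M * `|x|) ->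
  exists z, forall x, f x = '[x, z].
Proof.
move=> flin fM.
have [[v0 fv0]|f0] := pselect (exists v, f v != 0); last first.
  exists 0 => x; rewrite linear0r; apply/eqP/negPn/negP => fx.
  by apply: f0; exists x.
have fZ a x : f (a *: x) = a * f x.
  have f00 : f 0 = 0.
    by have := flin (-1) 0 0; rewrite scaler0 addr0 mulN1r addNr.
  by rewrite -[a *: x]addr0 flin f00 addr0.
have fD x y : f (x + y) = f x + f y by rewrite -[x]scale1r flin mul1r scale1r.
have fB x y : f (x - y) = f x - f y by rewrite fD -scaleN1r fZ mulN1r.
have [|d [dle dapp]] := @complex_inf _ _ [set v | f v = 1] (fun v => `|v| ^+ 2) _
  (fun v => exprn_ge0 2 (normr_ge0 v)).
  by exists ((f v0)^-1 *: v0); rewrite /= fZ mulVf.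
(* With this excess over the infimum, the parallelogram law bounds the distance
   between the terms of ranks [n <= m] by [n.+1%:R^-1]. *)
pose c n : R[i] := ((2 * n.+1%:R)^-1) ^+ 2.
have c0 n : 0 < c n by rewrite exprn_gt0// invr_gt0 mulr_gt0.
have /choice[v vP] n : exists v, f v = 1 /\ `|v| ^+ 2 < d + c n.
  by have [w] := dapp _ (c0 n); exists w.
have vcauchy n m : (n <= m)%N -> `|v n - v m| <= n.+1%:R^-1.
  move=> nm; rewrite -(@ler_pXn2r _ 2%N)// ?nnegrE ?invr_ge0//.
  have mid : 4 * d <= `|v n + v m| ^+ 2.
    have /dle : f (2^-1 *: (v n + v m)) = 1.
      by rewrite fZ fD !(vP _).1; field.
    rewrite normrZ exprMn ger0_norm ?invr_ge0//.
    rewrite -ler_pdivrMl ?exprn_gt0 ?invr_gt0//.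
    by rewrite exprVn invrK -natrX.
  have cm : c m <= c n.
    rewrite ler_pXn2r ?nnegrE ?invr_ge0 ?mulr_ge0// lef_pV2 ?posrE ?mulr_gt0//.
    by rewrite ler_pM2l// ler_nat.
  have -> : n.+1%:R^-1 ^+ 2 = 4 * c n by rewrite /c; field; rewrite nat1r.
  have := parallelogram (v n) (v m).
  rewrite -(lerD2l (`|v n + v m| ^+ 2)) => ->.
  apply: le_trans (lerD mid (lexx _)).
  rewrite -mulrDr (_ : 4 = 2 * 2); last by rewrite -natrM.
  rewrite -mulrA ler_pM2l// mulr_natl mulr2n.
  by rewrite lerD ?(ltW (vP n).2)// (le_trans (ltW (vP m).2))// lerD2l.
have [l lP] : exists l, forall n, `|v n - l| <= n.+1%:R^-1.
  by apply: (@cauchy_rate_cvg _ H) => //; exact: exists_natSinv_lt.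
have fl : f l = 1.
  apply/eqP; rewrite -subr_eq0; apply/eqP/(@eq0_le_natSinv _ _ `|M|) => n.
  have -> : f l - 1 = - f (v n - l) by rewrite fB (vP n).1 opprB.
  by rewrite normrN (le_trans (le_mul_norm _ _ (fM _)))// ler_wpM2l.
have orth k : f k = 0 -> '[k, l] = 0.
  move=> fk; apply: (@eq0_le_natSinv _ _ (2 * `|k|)) => n.
  have gap : `|'[v n, k]| <= `|k| * n.+1%:R^-1.
    rewrite -(@ler_pXn2r _ 2%N)// ?nnegrE ?mulr_ge0 ?invr_ge0//.
    have gap : `|'[v n, k]| ^+ 2 <= (`|v n| ^+ 2 - d) * `|k| ^+ 2.
      apply: sqr_inner_le_gap => a; apply: dle.
      by rewrite /= fD fZ fk mulr0 addr0 (vP n).1.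
    apply: le_trans gap _; rewrite exprMn mulrC ler_wpM2l ?exprn_ge0//.
    rewrite lerBlDl (le_trans (ltW (vP n).2))// lerD2l.
    rewrite ler_pXn2r ?nnegrE ?invr_ge0 ?mulr_ge0//.
    by rewrite lef_pV2 ?posrE ?mulr_gt0// ler_peMl// ler1n.
  rewrite -[l](subKr (v n)) linearBr /= (le_trans (ler_normB _ _))//.
  rewrite -mulrA mulr_natl mulr2n lerD//; first by rewrite innerC norm_conjC.
  by rewrite (le_trans (CauchySchwarz_inner _ _))// ler_wpM2l.
have l0 : l != 0.
  apply/eqP => l0; move: fl; rewrite l0 -(scale0r 0) fZ mul0r => /esym/eqP.
  by rewrite oner_eq0.
have nl0 : 0 < `|l| ^+ 2 by rewrite exprn_gt0// normr_gt0.
exists (`|l| ^- 2 *: l) => x.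
have /orth : f (x - f x *: l) = 0 by rewrite fB fZ fl mulr1 subrr.
rewrite linearBl /= innerZl inner_normE => /eqP; rewrite subr_eq0 => /eqP xl.
have lJ : (`|l| ^- 2)^* = `|l| ^- 2 by apply: geC0_conj; rewrite invr_ge0 ltW.
by rewrite innerZr lJ xl mulrC mulfK ?gt_eqF.
Qed.

Lemma adjoint_exists (S : H -> H) (M : R[i]) :
  (forall a x y, S (a *: x + y) = a *: S x + S y) ->
  (forall x, `|S x| <= M * `|x|) ->
  exists S' : H -> H, (forall x y, '[S x, y] = '[x, S' y]) /\
    exists M' : R[i], forall y, `|S' y| <= M' * `|y|.
Proof.
move=> Slin SM.
have SM' x : `|S x| <= `|M| * `|x| by exact: le_mul_norm (SM x).
have /choice[S' S'P] y : exists z, forall x, '[S x, y] = '[x, z].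
  apply: (riesz (f := fun x => '[S x, y]) (M := `|M| * `|y|)) => [a u v|x].
    by rewrite Slin linearDl /= innerZl.
  by rewrite (le_trans (CauchySchwarz_inner _ _))// mulrAC ler_wpM2r.
exists S'; split=> [x y|]; first exact: S'P.
exists `|M| => y.
have [->|S'y0] := eqVneq (S' y) 0; first by rewrite normr0 mulr_ge0.
have nS' : 0 < `|S' y| by rewrite normr_gt0.
rewrite -(ler_pM2l nS') -expr2 -inner_normE -S'P mulrCA mulrA.
rewrite (le_trans (real_ler_norm _))//.
  by rewrite S'P inner_normE ger0_real// exprn_ge0.
by rewrite (le_trans (CauchySchwarz_inner _ _))// ler_wpM2r.
Qed.

(** The pairing of [v] with itself attains its norm, and [D] approximates [v]. *)
Lemma dense_inner_bound (D : set H) (v : H) (C : R[i]) :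
  dense D -> 0 <= C -> (forall y, D y -> `|'[v, y]| <= C * `|y|) -> `|v| <= C.
Proof.
move=> Ddense C0 vC; rewrite real_leNgt ?ger0_real//; apply/negP => Cv.
pose e := (`|v| - C) / 2.
have e0 : 0 < e by rewrite divr_gt0// subr_gt0.
have ball0 : ball v e !=set0 by exists v; exact: ballxx.
have [y [vy Dy]] := @Ddense _ ball0 (ball_open v e).
move: vy; rewrite -ball_normE /= => /ltW vy.
have ny : `|y| <= `|v| + e.
  rewrite -[y](subKr v) (le_trans (ler_normB _ _))// lerD2l//.
have : `|v| ^+ 2 <= `|v| * e + C * (`|v| + e).
  rewrite -(@ger0_norm _ (`|v| ^+ 2)) ?exprn_ge0// -inner_normE.
  rewrite -[X in '[_, X]](subrK y) linearDr /=.
  rewrite (le_trans (ler_normD _ _))// lerD//.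
    by rewrite (le_trans (CauchySchwarz_inner _ _))// ler_wpM2l.
  by rewrite (le_trans (vC _ Dy))// ler_wpM2l.
rewrite -subr_ge0 (_ : _ - _ = - (e * (`|v| - C))); last by rewrite /e; field.
by rewrite oppr_ge0 lt_geF// mulr_gt0// subr_gt0.
Qed.
End Inner.

(** * Resolvents of unbounded operators *)

Section Resolvent.
Variables (R : realType) (H : hilbertType R).
Local Notation "''[' u , v ]" := (inner u v) : ring_scope.
Implicit Types (T : operator H) (S : H -> H) (l : R[i]).

(** The bounded inverse of [T - l], as a plain total function: this avoids
    carrying a proof of injectivity, and linearity follows. *)
Definition resolvent T l S : Prop :=
  [/\ forall y, dom T (S y) /\ T (S y) - l *: S y = y,
      forall x, dom T x -> S (T x - l *: x) = x &
      exists M : R[i], forall y, `|S y| <= M * `|y|].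

Lemma notin_spectrumP T l : ~ spectrum T l <-> exists S, resolvent T l S.
Proof.
split=> [/contrapT[Tinj [Tdom [M TM]]]|[S [SP ST SM]]].
  exists (inv_fun (op_shift T l)); split=> [y|x Tx|]; last by exists M.
  - have [x Tx <-] : (op_shift T l @` dom T) y.
      by have : [set: H] y := I; rewrite -Tdom.
    by rewrite inv_funE.
  - by rewrite -[T x - _]/(op_shift T l x) inv_funE.
move=> TS; apply: TS.
have Tinj : set_inj (dom (op_shift T l)) (op_shift T l).
  move=> x y; rewrite !inE => Tx Ty /= xy.
  by rewrite -(ST x Tx) xy ST.
exists Tinj.
have invE y : op_inv Tinj y = S y.
  have [Sy yE] := SP y; rewrite -[in LHS]yE.
  exact: (inv_funE Tinj).
split; last by have [M MP] := SM; exists M => x; rewrite invE.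
apply/seteqP; split=> // y _; exists (S y); first exact: (SP y).1.
exact: (SP y).2.
Qed.

Lemma resolvent_linear T l S : resolvent T l S ->
  forall a x y, S (a *: x + y) = a *: S x + S y.
Proof.
move=> [SP ST _] a x y.
have [[dx xE] [dy yE]] := (SP x, SP y).
have dz : dom T (a *: S x + S y) by exact: domL.
by rewrite -[RHS]ST// (shift_funL l a dx dy) xE yE.
Qed.

Lemma resolvent_adjoint T l S : resolvent T l S ->
  exists S' : H -> H, (forall x y, '[S x, y] = '[x, S' y]) /\
    exists M : R[i], forall y, `|S' y| <= M * `|y|.
Proof.
move=> TS; have [_ _ [M SM]] := TS.
exact: adjoint_exists (resolvent_linear TS) SM.
Qed.

Lemma selfadjoint_rel T x z :
  selfadjoint T -> adj_rel T x z -> dom T x /\ T x = z.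
Proof.
move=> [Td [domE funE]] xz.
have dx : dom (op_adj Td) x by exists z.
by rewrite -domE; split=> //; rewrite -(funE x dx); exact: adj_funE.
Qed.

Lemma selfadjoint_sym T x y : selfadjoint T -> dom T x -> dom T y ->
  '[T x, y] = '[x, T y].
Proof.
move=> sT Tx Ty; have [Td [domE funE]] := sT.
have [z yz] : dom (op_adj Td) y by rewrite domE.
by rewrite (selfadjoint_rel sT yz).2 yz.
Qed.
End Resolvent.

(** * The two products of a self-adjoint pair *)

Section Products.
Variables (R : realType) (H : hilbertType R) (A B : operator H).
Local Notation "''[' u , v ]" := (inner u v) : ring_scope.
Local Notation AB := (op_comp A B).
Local Notation BA := (op_comp B A).
Hypotheses (sA : selfadjoint A) (sB : selfadjoint B).
Hypothesis bB : everywhere_bounded B.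
Implicit Types (S : H -> H) (l m : R[i]).

Let Bdom x : dom B x.
Proof. by have [-> _] := bB. Qed.

Let domBA x : dom A x -> dom BA x.
Proof. by split=> //; exact: Bdom. Qed.

Let domAB x : dom A (B x) -> dom AB x.
Proof. by split=> //; exact: Bdom. Qed.

Lemma inner_BA_AB x y : dom A x -> dom A (B y) -> '[BA x, y] = '[x, AB y].
Proof.
by move=> Ax ABy; rewrite /= (selfadjoint_sym sB)// (selfadjoint_sym sA).
Qed.

(** Pairing with a vector [u] of the domain of [A] turns the equation
    [S (BA u - l u) = u] into a statement on the adjoint of [A] at [B (S' y)],
    that is on [A] itself. *)
Lemma resolvent_BA_AB l S : resolvent BA l S ->
  exists2 S', (forall x y, '[S x, y] = '[x, S' y]) & resolvent AB l^* S'.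
Proof.
move=> BAS; have [S' [SS' S'M]] := resolvent_adjoint BAS.
exists S' => //; have [SP ST _] := BAS; split=> // [y|x [_ ABx]].
  have [ABy ABE] : dom A (B (S' y)) /\ A (B (S' y)) = y + l^* *: S' y.
    apply: selfadjoint_rel => // u Au.
    have := SS' (BA u - l *: u) y; rewrite ST; last exact: domBA.
    rewrite linearBl /= innerZl (selfadjoint_sym sB)//.
    rewrite linearDr /= innerZr conjCK => ->.
    by rewrite subrK.
  by split; [exact: domAB | rewrite /= ABE addrK].
apply: inner_injr => z; have [[ASz _] zE] := SP z.
rewrite -SS' linearBr /= innerZr conjCK -inner_BA_AB//.
by rewrite -innerZl -linearBl /= zE.
Qed.

(** [S'] takes its values in the domain of [BA] because of the resolvent
    identity, which expresses it through [S0]. *)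
Lemma resolvent_AB_BA l0 S0 m S : resolvent BA l0 S0 -> resolvent AB m S ->
  exists S', resolvent BA m^* S'.
Proof.
move=> BAS0 ABS; have [S' [SS' S'M]] := resolvent_adjoint ABS.
exists S'; have [S0P _ _] := BAS0; have [SP ST _] := ABS.
have [S0' S0S' [S0P' _ _]] := resolvent_BA_AB BAS0.
(* Resolvent identity between [S] and the adjoint of [S0]. *)
have SE z : S z = (m - l0^*) *: S (S0' z) + S0' z.
  have [ABz zE] := S0P' z.
  rewrite -[X in _ + X](ST _ ABz) -(resolvent_linear ABS) -[in LHS]zE.
  by congr S; rewrite scalerBl [RHS]addrC addrA subrK.
(* Its adjoint. *)
have S'E y : S' y = S0 ((m^* - l0) *: S' y + y).
  apply: inner_injr => z.
  rewrite -SS' [RHS]innerC S0S' -innerC SE linearDl linearDr /= innerZl innerZr.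
  by rewrite rmorphB /= conjCK -SS'.
split=> // [y|x BAx].
  have [] := S0P ((m^* - l0) *: S' y + y).
  rewrite -S'E => BAy yE; split=> //.
  move/eqP: yE; rewrite subr_eq => /eqP ->.
  by rewrite scalerBl [_ + y + _]addrAC subrK [_ + y]addrC addrK.
apply: inner_injr => z; have [[_ ABz] zE] := SP z.
have ABE : '[S z, B (A x)] = '[A (B (S z)), x].
  by rewrite innerC (inner_BA_AB BAx.1 ABz) -innerC.
by rewrite -SS' linearBr /= innerZr conjCK ABE -innerZl -linearBl /= zE.
Qed.

(** For [y] in the domain of [A], the inner product of [A (S x)] with [y] is the
    one of [x] with [S' (A y)]. Fixing [x], this bounds the vectors
    [S' (A y) / `|y|] weakly, hence in norm, and the resulting estimate passes to
    [A (S x)] by density of the domain of [A]. *)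
Lemma bounded_A_resolvent l S : resolvent BA l S ->
  exists M : R[i], forall x, `|A (S x)| <= M * `|x|.
Proof.
move=> BAS; have [SP _ _] := BAS.
have [S' [SS' _]] := resolvent_adjoint BAS.
have ASE x y : dom A y -> '[A (S x), y] = '[x, S' (A y)].
  by move=> Ay; have [[ASx _] _] := SP x; rewrite (selfadjoint_sym sA).
have [|M MP] := @weakly_bounded_bounded _ H
  [set `|y|^-1 *: S' (A y) | y in dom A].
  move=> x; exists `|A (S x)| => _ [y Ay <-].
  rewrite innerZr -ASE// normrM norm_conjC normfV normr_id.
  have [->|y0] := eqVneq y 0; first by rewrite linear0r !normr0 mulr0.
  by rewrite ler_pdivrMl ?normr_gt0// mulrC CauchySchwarz_inner.
have [Ad _] := sA.
exists `|M| => x; apply: (dense_inner_bound Ad) => [|y Ay].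
  by rewrite mulr_ge0.
have [->|y0] := eqVneq y 0; first by rewrite linear0r !normr0 mulr0.
have ny : 0 < `|y| by rewrite normr_gt0.
have SA : `|S' (A y)| <= `|M| * `|y|.
  apply: le_mul_norm => //; have := MP _ (ex_intro2 _ _ y Ay erefl).
  by rewrite normrZ ger0_norm ?invr_ge0// ler_pdivrMl// mulrC.
rewrite ASE// (le_trans (CauchySchwarz_inner _ _))//.
by rewrite [leRHS]mulrAC mulrC ler_wpM2r.
Qed.

(** Formally [(AB - l)^-1 = (A (BA - l)^-1 B - 1) / l], as for bounded operators;
    the key point is that [B] maps the right-hand side to [S \o B], whose values
    lie in the domain of [A]. *)
Lemma resolvent_BA_AB_neq0 l S : l != 0 -> resolvent BA l S ->
  resolvent AB l (fun x => l^-1 *: (A (S (B x)) - x)).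
Proof.
move=> l0 BAS; have [SP ST _] := BAS.
have BSE y : B (A (S (B y)) - y) = l *: S (B y).
  have [_ yE] := SP (B y).
  have BL := op_funL (-1) (Bdom y) (Bdom (A (S (B y)))).
  rewrite addrC -scaleN1r BL scaleN1r addrC -[X in _ - X]yE.
  by rewrite opprB addrC subrK.
split=> [y|x [_ ABx]|].
- have [[ASy _] _] := SP (B y).
  have BE : B (l^-1 *: (A (S (B y)) - y)) = S (B y).
    have := op_funL l^-1 (Bdom (A (S (B y)) - y)) (dom0 B).
    by rewrite !addr0 op_fun0 addr0 BSE scalerA mulVf// scale1r.
  split; first by apply: domAB; rewrite BE.
  by rewrite /= BE scalerA mulfV// scale1r subKr.
- have BL : B (A (B x) - l *: x) = B (A (B x)) - l *: B x.
    have := op_funL (- l) (Bdom x) (Bdom (A (B x))).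
    by rewrite !scaleNr ![- _ + _]addrC.
  rewrite /= BL ST; last exact: domBA.
  by rewrite subKr scalerA mulVf// scale1r.
- have [M MP] := bounded_A_resolvent BAS; have [_ [N NP]] := bB.
  exists (`|l^-1| * (`|M| * `|N| + 1)) => x.
  rewrite normrZ -mulrA ler_wpM2l// mulrDl mul1r.
  rewrite (le_trans (ler_normB _ _))// lerD2r.
  rewrite (le_trans (le_mul_norm _ _ (MP _)))// -mulrA ler_wpM2l//.
  exact: le_mul_norm (NP _).
Qed.

Lemma spectrum_AB_BA : spectrum BA <> setT -> spectrum AB = spectrum BA.
Proof.
move=> BAneT.
have [l0 /notin_spectrumP[S0 BAS0]] : exists l, ~ spectrum BA l.
  by apply/existsNP => BAT; apply: BAneT; apply/seteqP; split.
have to_conj l : ~ spectrum AB l -> ~ spectrum BA l^*.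
  move=> /notin_spectrumP[S ABS]; apply/notin_spectrumP.
  exact: resolvent_AB_BA BAS0 ABS.
have to_AB l : ~ spectrum BA l -> ~ spectrum AB l.
  move=> /notin_spectrumP[S BAS]; apply/notin_spectrumP.
  have [l00|l00] := eqVneq l 0; last first.
    by eexists; exact: resolvent_BA_AB_neq0 BAS.
  by have [S' _] := resolvent_BA_AB BAS; rewrite l00 conjC0; exists S'.
apply/seteqP; split=> l; apply: contraPP; first exact: to_AB.
by move=> /to_conj /to_AB /to_conj; rewrite conjCK.
Qed.
End Products.

Theorem corollary3p5 (R : realType) (H : hilbertType R) (A B : operator H) :
  separable H ->
  selfadjoint A ->
  selfadjoint B ->
  everywhere_bounded B ->
  spectrum (op_comp B A) <> setT ->
  spectrum (op_comp A B) = spectrum (op_comp B A).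
Proof. by move=> _; exact: spectrum_AB_BA. Qed.
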